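(* Let $I$ be an ideal of a dual weak brace $(S,+,\circ)$. Then the relation $\sim_I$ on $S$ given by $$\forall\, a,b\in S\qquad a\sim_I b\iff a^0=b^0\ \text{ and }\ -a+b\in I$$ is a congruence of $(S,+,\circ)$. Moreover, $S/{\sim_I}$ is a dual weak brace with semilattice of idempotents isomorphic to $E(S)$.
   Context: A Clifford semigroup is an inverse semigroup with central idempotents. A weak brace is a triple $(S,+,\circ)$ such that $(S,+)$ and $(S,\circ)$ are inverse semigroups and, for all $a,b,c\in S$, $a\circ(b+c)=a\circ b-a+a\circ c$ and $a\circ a^-=-a+a$, where $-a$ and $a^-$ are the inverses of $a$ in $(S,+)$ and $(S,\circ)$ respectively, and $\circ$ has higher precedence than $+$. In a weak brace, $(S,+)$ is always a Clifford semigroup, and the idempotents of $(S,+)$ and $(S,\circ)$ coincide (with the two operations agreeing on them); their set is denoted $E(S)$. A dual weak brace is a weak brace in which $(S,\circ)$ is a Clifford semigroup. In a dual weak brace, $a^0:=a-a=-a+a=a\circ a^-=a^-\circ a$. A congruence of $(S,+,\circ)$ is an equivalence relation compatible with both operations. For $a,b\in S$, $\lambda_a(b):=-a+a\circ b$. A subset $N$ of a Clifford semigroup $S$ (written multiplicatively, with $a^0=aa^{-1}=a^{-1}a$) is normal if: (1) $E(S)\subseteq N$; (2) $a\in N\Rightarrow a^{-1}\in N$; (3) $a,\ a^0b\in N\Rightarrow ab\in N$; (4) $ab\in N\Rightarrow ba\in N$, for all $a,b\in S$. An ideal of a dual weak brace $(S,+,\circ)$ is a subset $I\subseteq S$ such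 that $I$ is a normal subset of $(S,+)$, $\lambda_a(I)\subseteq I$ for every $a\in S$, and $I$ is a normal subset of $(S,\circ)$. *)

(* Defs.v *)
From Stdlib Require Export RelationClasses Morphisms.
From mathcomp Require Export all_boot.
From mathcomp Require Export boolp classical_sets functions.

Set Implicit Arguments.
Unset Strict Implicit.
Unset Printing Implicit Defensive.

Local Open Scope classical_set_scope.

Section InverseSemigroups.
Variables (S : Type) (op : S -> S -> S).

Definition inverse_of (a b : S) : Prop :=
  op (op a b) a = a /\ op (op b a) b = b.

Definition inverse_semigroup : Prop :=
  associative op /\ forall a, exists! b, inverse_of a b.

(* The value a when no inverse exists is junk; in an inverse semigroup it is
   never used, see [sginvP]. *)
Definition sginv (a : S) : S :=
  if pselect (exists b, inverse_of a b) is left h then sval (cid h) else a.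

Lemma sginvP : inverse_semigroup ->
  forall a b, inverse_of a b <-> b = sginv a.
Proof.
move=> [_ uni] a b; have [c [hc cU]] := uni a.
suff <- : c = sginv a by split=> [/cU ->|->].
apply: cU; rewrite /sginv; case: pselect => [h|[]]; last by exists c.
by case: (cid h).
Qed.

Definition pow0 (a : S) : S := op a (sginv a).

Definition idempotents : set S := [set e | op e e = e].

Definition clifford_semigroup : Prop :=
  inverse_semigroup /\ forall e a, idempotents e -> op e a = op a e.

Definition normal_subset (N : set S) : Prop :=
  [/\ idempotents `<=` N,
      forall a, N a -> N (sginv a),
      forall a b, N a -> N (op (pow0 a) b) -> N (op a b) &
      forall a b, N (op a b) -> N (op b a)].

End InverseSemigroups.

Section WeakBraces.
Variables (S : Type) (add circ : S -> S -> S).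

Local Notation "a + b" := (add a b).
Local Notation "- a" := (sginv add a).
Local Notation "a - b" := (add a (- b)).
Local Notation "a ∘ b" := (circ a b) (at level 40, left associativity).

Definition weak_brace : Prop :=
  [/\ inverse_semigroup add,
      inverse_semigroup circ,
      forall a b c, a ∘ (b + c) = a ∘ b - a + a ∘ c &
      forall a, a ∘ sginv circ a = - a + a].

Definition dual_weak_brace : Prop := weak_brace /\ clifford_semigroup circ.

Definition lambda (a b : S) : S := - a + a ∘ b.

Definition ideal (I : set S) : Prop :=
  [/\ normal_subset add I,
      forall a, lambda a @` I `<=` I &
      normal_subset circ I].

Definition ideal_rel (I : set S) (a b : S) : Prop :=
  pow0 add a = pow0 add b /\ I (- a + b).

Definition compatible (R : S -> S -> Prop) (op : S -> S -> S) : Prop :=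
  Proper (R ==> R ==> R)%signature op.

Record congruence (R : S -> S -> Prop) : Prop := Congruence {
  cong_equiv : Equivalence R;
  cong_add : compatible R add;
  cong_circ : compatible R circ }.

End WeakBraces.

(* The quotient is the type of equivalence classes, as subsets of S. *)
Section Quotient.
Variables (S : Type) (R : S -> S -> Prop).

Definition quotient : Type := {C : set S | exists a, C = [set b | R a b]}.

Definition class (a : S) : quotient :=
  exist _ [set b | R a b] (ex_intro _ a erefl).

Variables (op : S -> S -> S) (eqR : Equivalence R) (opR : compatible R op).

Let class_op (C D : set S) : set S :=
  [set z | exists x y, [/\ C x, D y & R (op x y) z]].

Let class_opE a b :
  class_op [set x | R a x] [set y | R b y] = [set z | R (op a b) z].
Proof.
apply/seteqP; split=> z /= => [[x [y [ax bY xyz]]]|abz].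
  by apply: (transitivity _ xyz); exact: opR.
by exists a, b; split=> //=; exact: reflexivity.
Qed.

Let class_op_class (C D : quotient) :
  exists a, class_op (sval C) (sval D) = [set z | R a z].
Proof.
have [a ->] := svalP C; have [b ->] := svalP D.
by exists (op a b); exact: class_opE.
Qed.

Definition quotient_op (C D : quotient) : quotient :=
  exist _ (class_op (sval C) (sval D)) (class_op_class C D).

Lemma quotient_op_class a b :
  quotient_op (class a) (class b) = class (op a b).
Proof. exact/eq_exist/class_opE. Qed.

End Quotient.

Section QuotientByCongruence.
Variables (S : Type) (add circ : S -> S -> S) (R : S -> S -> Prop).
Hypothesis congR : congruence add circ R.

Definition quotient_add : quotient R -> quotient R -> quotient R :=
  quotient_op (cong_equiv congR) (cong_add congR).

Definition quotient_circ : quotient R -> quotient R -> quotient R :=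
  quotient_op (cong_equiv congR) (cong_circ congR).

End QuotientByCongruence.

(* In a weak brace the idempotents of the two operations coincide and form a
   semilattice on which the operations agree; an isomorphism preserves both. *)
Definition idempotents_isomorphic (X : Type) (addX circX : X -> X -> X)
    (Y : Type) (addY circY : Y -> Y -> Y) : Prop :=
  exists f : X -> Y,
    [/\ set_bij (idempotents addX) (idempotents addY) f,
        forall e e', idempotents addX e -> idempotents addX e' ->
          f (addX e e') = addY (f e) (f e') &
        forall e e', idempotents addX e -> idempotents addX e' ->
          f (circX e e') = circY (f e) (f e')].

(* Main.v *)
Require Import Defs.

Set Implicit Arguments.
Unset Strict Implicit.
Unset Printing Implicit Defensive.

Local Open Scope classical_set_scope.

(** The degree [a^0] of an element of a dual weak brace is a homomorphism for
    both operations.  If [a] and [b] have the same degree, [lambda a] maps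
    [a^- ∘ b] to [-a + b] and [lambda a^-] maps [-a + b] back to [a^- ∘ b], so
    that an ideal contains one iff it contains the other.  Hence [~_I] is at
    once the relation attached to the normal subset [I] of the Clifford
    semigroup [(S, +)] and the one attached to the normal subset [I] of
    [(S, ∘)], and each description gives compatibility with one operation.
    An idempotent class contains exactly one idempotent of [S], the common
    degree of its elements. *)

(** * Inverse semigroups and commuting idempotents *)

Section InverseSemigroupTheory.
Variables (S : Type) (op : S -> S -> S).
Hypothesis invS : inverse_semigroup op.

Local Notation "a * b" := (op a b).
Local Notation "a ^-1" := (sginv op a).

Let opA : associative op. Proof. by case: invS. Qed.

Lemma sginv_inverse a : inverse_of op a a^-1.
Proof. exact/(sginvP invS). Qed.

Lemma sginv_unique a b : inverse_of op a b -> b = a^-1.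
Proof. by move/(sginvP invS). Qed.

Lemma op_sginvK a : a * a^-1 * a = a.
Proof. by case: (sginv_inverse a). Qed.

Lemma sginv_opK a : a^-1 * a * a^-1 = a^-1.
Proof. by case: (sginv_inverse a). Qed.

Lemma sginvK a : a^-1^-1 = a.
Proof.
by apply/esym/sginv_unique; split; [exact: sginv_opK|exact: op_sginvK].
Qed.

Lemma sginv_idempotent e : idempotents op e -> e^-1 = e.
Proof. by move=> ee; apply/esym/sginv_unique; split; rewrite ee. Qed.

Lemma pow0_of_idempotent e : idempotents op e -> pow0 op e = e.
Proof. by move=> ee; rewrite /pow0 sginv_idempotent. Qed.

Lemma pow0_idempotent a : idempotents op (pow0 op a).
Proof. by rewrite /idempotents /= /pow0 opA op_sginvK. Qed.

Lemma sginv_op_idempotent a : idempotents op (a^-1 * a).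
Proof. by rewrite /idempotents /= opA sginv_opK. Qed.

(* If [x] is the inverse of [e * f], then [f * x * e] is an idempotent inverse
   of [e * f]. *)
Lemma idempotents_op e f :
  idempotents op e -> idempotents op f -> idempotents op (e * f).
Proof.
rewrite /idempotents /= => ee ff; set x := (e * f)^-1.
have [xl xr] : e * f * x * (e * f) = e * f /\ x * (e * f) * x = x.
  by split; [exact: op_sginvK|exact: sginv_opK].
have yy : idempotents op (f * x * e).
  by rewrite /idempotents /= -[in RHS]xr !opA.
have yinv : inverse_of op (f * x * e) (e * f).
  split; last by rewrite -[RHS]xl !opA -(opA e f f) ff -(opA _ e e) ee.
  by rewrite !opA -(opA _ e e) ee -(opA _ f f) ff -[in RHS]xr !opA.
by rewrite (sginv_unique yinv) sginv_idempotent.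
Qed.

(** Both products are idempotent, and [f * e] is an inverse of [e * f], whose unique inverse is
    itself. *)
Lemma idempotents_comm e f :
  idempotents op e -> idempotents op f -> e * f = f * e.
Proof.
move=> ee ff; have efef := idempotents_op ee ff.
have fefe := idempotents_op ff ee.
rewrite -[LHS]sginv_idempotent //; apply/esym/sginv_unique; split.
  by rewrite -[RHS]efef !opA -(opA e f f) ff -(opA _ e e) ee.
by rewrite -[RHS]fefe !opA -(opA f e e) ee -(opA _ f f) ff.
Qed.

Lemma sginvM a b : (a * b)^-1 = b^-1 * a^-1.
Proof.
have C := idempotents_comm (pow0_idempotent b) (sginv_op_idempotent a).
rewrite /pow0 in C.
apply/esym/sginv_unique; split.
  transitivity (a * (b * b^-1 * (a^-1 * a)) * b); first by rewrite !opA.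
  by rewrite C !opA op_sginvK -!opA (opA b) op_sginvK.
transitivity (b^-1 * (a^-1 * a * (b * b^-1)) * a^-1); first by rewrite !opA.
by rewrite -C !opA sginv_opK -!opA (opA a^-1) sginv_opK.
Qed.

(** The hypothesis at [e * a] turns [e * a = a * (a^-1 * e * e * a)] into [a * (e * a * a^-1 * e)],
    which commuting idempotents reduce to [a * e]. *)
Lemma commuting_inverses_clifford :
  (forall a, a * a^-1 = a^-1 * a) -> clifford_semigroup op.
Proof.
move=> comm; split=> // e a ee.
have := comm (e * a); rewrite sginvM (sginv_idempotent ee) => C.
have pa := pow0_idempotent a.
transitivity (a * (a^-1 * e * (e * a))).
  rewrite !opA -(opA _ e e) ee -(opA _ e a) opA.
  by rewrite (idempotents_comm pa ee) -opA op_sginvK.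
rewrite -C !opA -!opA (opA a a^-1 e) -/(pow0 op a) (idempotents_comm pa ee).
by rewrite /pow0 comm (opA e e) ee (idempotents_comm ee (sginv_op_idempotent a))
  opA opA op_sginvK.
Qed.

End InverseSemigroupTheory.

(** * Degrees in a Clifford semigroup *)

Section CliffordTheory.
Variables (S : Type) (op : S -> S -> S).
Hypothesis cliffS : clifford_semigroup op.

Local Notation "a * b" := (op a b).
Local Notation "a ^-1" := (sginv op a).
Local Notation "a ^0" := (pow0 op a) (at level 2, format "a ^0").

Let invS : inverse_semigroup op. Proof. by case: cliffS. Qed.
Let opA : associative op. Proof. by case: invS. Qed.

Lemma idempotent_central e a : idempotents op e -> e * a = a * e.
Proof. by case: cliffS => _; apply. Qed.

(** By centrality, the product of the two idempotents equals each of them. *)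
Lemma sginv_op a : a^-1 * a = a^0.
Proof.
have pa := pow0_idempotent invS a; have qa := sginv_op_idempotent invS a.
transitivity (a^0 * (a^-1 * a)).
  by rewrite opA (idempotent_central _ pa) -opA (op_sginvK invS).
by rewrite -opA -(idempotent_central _ qa) (sginv_opK invS).
Qed.

Lemma pow0_op a : a^0 * a = a.
Proof. exact: op_sginvK. Qed.

Lemma pow0_sginv a : pow0 op a^-1 = a^0.
Proof. by rewrite {1}/pow0 sginvK // sginv_op. Qed.

Lemma pow0M a b : (a * b)^0 = a^0 * b^0.
Proof.
rewrite {1}/pow0 sginvM // opA -(opA a) -/(pow0 op b).
by rewrite -(idempotent_central a (pow0_idempotent invS b)) -opA
  (idempotent_central _ (pow0_idempotent invS b)).
Qed.

End CliffordTheory.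

(** * The congruence attached to a normal subset *)

Section NormalSubsets.
Variables (S : Type) (op : S -> S -> S) (N : set S).
Hypotheses (cliffS : clifford_semigroup op) (normN : normal_subset op N).

Local Notation "a * b" := (op a b).
Local Notation "a ^-1" := (sginv op a).
Local Notation "a ^0" := (pow0 op a) (at level 2, format "a ^0").

Let invS : inverse_semigroup op. Proof. by case: cliffS. Qed.
Let opA : associative op. Proof. by case: invS. Qed.

Lemma normal_op_idempotent a e : N a -> idempotents op e -> N (a * e).
Proof.
case: normN => EN _ N3 _ aN ee; apply: N3 => //.
exact/EN/idempotents_op/ee/pow0_idempotent.
Qed.

Lemma normal_op a b : N a -> N b -> N (a * b).
Proof.
case: normN => _ _ N3 _ aN bN; apply: N3 => //.
have pa := pow0_idempotent invS a.
by rewrite (idempotent_central cliffS) //; exact: normal_op_idempotent.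
Qed.

(** The fourth normality condition rotates the product to [a * b^0]. *)
Lemma normal_conj a b : N a -> N (b^-1 * a * b).
Proof.
case: normN => _ _ _ N4 aN; rewrite -opA; apply: N4; rewrite -opA.
exact/normal_op_idempotent/pow0_idempotent.
Qed.

Lemma ideal_rel_equivalence : Equivalence (ideal_rel op N).
Proof.
have [EN NV _ _] := normN; split.
- by move=> a; split=> //; exact/EN/sginv_op_idempotent.
- by move=> a b [ab abN]; split=> //; have := NV _ abN; rewrite sginvM ?sginvK.
- move=> a b c [ab abN] [bc bcN]; split; first by rewrite ab.
  (* The product is [a^-1 * b^0 * c], and [b^0 = c^0] is absorbed by [c]. *)
  have := normal_op abN bcN; rewrite opA -(opA _ b) -/(pow0 op b) -opA bc.
  by rewrite (pow0_op cliffS).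
Qed.

(* [(a b)^-1 (a' b') = (b^-1 (a^-1 a') b) (b^-1 b')] when [b^0 = b'^0]. *)
Lemma ideal_rel_compatible : compatible (ideal_rel op N) op.
Proof.
move=> a a' [aa' aN] b b' [bb' bN]; split; first by rewrite !pow0M // aa' bb'.
have := normal_op (normal_conj b aN) bN; rewrite sginvM // !opA.
by rewrite -(opA _ b) -/(pow0 op b) -(opA _ (b^0)) bb' (pow0_op cliffS).
Qed.

(** [(a * a)^-1 * a] equals [a^-1 * a^0], exactly the element tested in [a ~ a^0]. *)
Lemma ideal_rel_square a : ideal_rel op N (a * a) a -> ideal_rel op N a a^0.
Proof.
move=> [_]; rewrite sginvM // -opA (sginv_op cliffS) => aN; split.
  exact/esym/pow0_of_idempotent/pow0_idempotent.
exact: aN.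
Qed.

End NormalSubsets.

Lemma regular_clifford (S : Type) (op : S -> S -> S) :
  associative op -> (forall a, exists b, inverse_of op a b) ->
  (forall e a, idempotents op e -> op e a = op a e) -> clifford_semigroup op.
Proof.
move=> opA reg central; split=> //; split=> // a; have [b ab] := reg a.
exists b; split=> // c [aca cac]; have [aba bab] := ab.
(* Two inverses [b] and [c] of [a] both equal [b a c]. *)
have ib : idempotents op (op a b) by rewrite /idempotents /= opA aba.
have ic : idempotents op (op c a) by rewrite /idempotents /= opA cac.
transitivity (op b (op a c)).
  by rewrite -[LHS]bab -[in LHS]aca -!opA (opA a c) -(central _ _ ib) !opA bab.
rewrite -[RHS]cac -[in RHS]aba !opA -(opA _ b) (central _ _ ic) -!opA.
by rewrite (opA c) cac.
Qed.

(** * Quotients of Clifford semigroups *)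

Section QuotientTheory.
Variables (S : Type) (R : S -> S -> Prop) (op : S -> S -> S).
Hypotheses (eqR : Equivalence R) (opR : compatible R op).

Lemma class_eq a b : class R a = class R b <-> R a b.
Proof.
split=> [[/seteqP[_ /(_ b)]]|ab]; first by apply; exact: reflexivity.
apply: eq_exist; apply/seteqP; split=> c /=; apply: transitivity => //.
exact: symmetry.
Qed.

Lemma quotient_classP (X : quotient R) : exists a, X = class R a.
Proof. by case: X => C [a Ca]; exists a; exact: eq_exist. Qed.

Local Notation qop := (quotient_op eqR opR).

Hypothesis cliffS : clifford_semigroup op.
Hypothesis squareR : forall a, R (op a a) a -> R a (pow0 op a).

Let invS : inverse_semigroup op. Proof. by case: cliffS. Qed.

Lemma idempotent_class a :
  idempotents qop (class R a) -> class R a = class R (pow0 op a).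
Proof.
by rewrite /idempotents /= quotient_op_class => /class_eq /squareR /class_eq.
Qed.

Lemma inverse_of_class a : inverse_of qop (class R a) (class R (sginv op a)).
Proof.
by rewrite /inverse_of !quotient_op_class (op_sginvK invS) (sginv_opK invS).
Qed.

(** Idempotent classes lift to idempotents of [S], so they are central; [regular_clifford] then
    gives uniqueness of inverses. *)
Lemma quotient_clifford : clifford_semigroup qop.
Proof.
have [opA _] := invS; apply: regular_clifford.
- move=> X Y Z; have [a ->] := quotient_classP X.
  have [b ->] := quotient_classP Y; have [c ->] := quotient_classP Z.
  by rewrite !quotient_op_class opA.
- move=> X; have [a ->] := quotient_classP X.
  by exists (class R (sginv op a)); exact: inverse_of_class.
- move=> E X; have [e ->] := quotient_classP E; have [a ->] := quotient_classP X.
  move=> /idempotent_class ->; rewrite !quotient_op_class.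
  by rewrite (idempotent_central cliffS) //; exact: pow0_idempotent.
Qed.

Lemma sginv_class a : sginv qop (class R a) = class R (sginv op a).
Proof.
have [invQ _] := quotient_clifford.
by apply/esym/(sginvP invQ)/inverse_of_class.
Qed.

End QuotientTheory.

(** * Dual weak braces and their ideals *)

Section DualWeakBraceTheory.
Variables (S : Type) (add circ : S -> S -> S).

Local Notation "a + b" := (add a b).
Local Notation "- a" := (sginv add a).
Local Notation "a - b" := (add a (- b)).
Local Notation "a ∘ b" := (circ a b) (at level 40, left associativity).

(* With [e := - a + a], the element [e + e ∘ (- a) + e] is an inverse of [a], so
   [- a + e = - a], that is, [a - a <= - a + a] in the order of idempotents;
   exchanging [a] and [- a] gives equality. *)
Lemma weak_brace_add_clifford :
  weak_brace add circ -> clifford_semigroup add.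
Proof.
case=> invA invC dist cV; have [addA _] := invA.
have absorb a : - a + (- a + a) = - a.
  have ee := sginv_op_idempotent invA a.
  have ec : - a + a = pow0 circ a by rewrite /pow0 cV.
  have cee : (- a + a) ∘ (- a + a) = - a + a.
    by rewrite ec; exact: pow0_idempotent.
  have cea : (- a + a) ∘ a = a by rewrite ec; exact: op_sginvK.
  have ae : a + (- a + a) = a by rewrite addA op_sginvK.
  (* With [e := - a + a], this expands [e = e ∘ (- a + a)] by distributivity, using [- e = e] and
     [e ∘ a = a]. *)
  have ex : (- a + a) ∘ (- a) + (- a + a) + a = - a + a.
    rewrite -[RHS]cee [in RHS](dist (- a + a)) cea.
    by rewrite (sginv_idempotent invA ee).
  move: (- a + a) ee cee cea ae ex => e ee _ _ ae ex.
  have -> : - a = e + (e ∘ (- a) + e).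
    apply/esym/(sginv_unique invA); split.
      by rewrite -!addA (addA (e ∘ _)) ex ee ae.
    by rewrite -(addA e) ex ee addA ee.
  by rewrite -!addA ee.
have pq a : pow0 add a + (- a + a) = pow0 add a by rewrite /pow0 -addA absorb.
apply: (commuting_inverses_clifford invA) => a.
have := pq (- a); rewrite /pow0 (sginvK invA) => <-.
rewrite -/(pow0 add a) (idempotents_comm invA) ?pq //.
  exact: sginv_op_idempotent.
exact: pow0_idempotent.
Qed.

Hypothesis brace_S : dual_weak_brace add circ.

Let braceS : weak_brace add circ. Proof. by case: brace_S. Qed.
Let cliffA : clifford_semigroup add. Proof. exact: weak_brace_add_clifford. Qed.
Let cliffC : clifford_semigroup circ. Proof. by case: brace_S. Qed.

Lemma pow0_add_circ : pow0 add = pow0 circ.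
Proof.
have [_ _ _ cV] := braceS.
by apply/funext => a; rewrite -(sginv_op cliffA) -cV.
Qed.

Lemma ideal_rel_add_circ I :
  ideal add circ I -> ideal_rel add I = ideal_rel circ I.
Proof.
have [[addA _] [circA _] dist _] := braceS.
case=> _ lamI _; apply/funext => a; apply/funext => b; apply/propext.
have lamIE x y : I y -> I (lambda add circ x y).
  by move=> Iy; apply: (lamI x); exists y.
rewrite /ideal_rel -pow0_add_circ.
split=> -[ab abI]; split=> //; set a' := sginv circ a.
  (* Write [b = a + (- a + b)], by equality of degrees, and distribute: [a' ∘ a] is the additive
     degree of [- a'], so [a' ∘ a - a'] collapses to [- a']. *)
  have -> : a' ∘ b = lambda add circ a' (- a + b).
    rewrite -[in LHS](pow0_op cliffA b) -ab /pow0 -addA dist.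
    have <- : pow0 add (- a') = a' ∘ a.
      by rewrite (pow0_sginv cliffA) (sginv_op cliffC) pow0_add_circ
        (pow0_sginv cliffC).
    by rewrite (pow0_op cliffA).
  exact: lamIE.
have -> : - a + b = lambda add circ a (a' ∘ b).
  by rewrite /lambda circA -/(pow0 circ a) -pow0_add_circ ab pow0_add_circ
    (pow0_op cliffC).
exact: lamIE.
Qed.

End DualWeakBraceTheory.

(** * The quotient brace and its idempotents *)

Theorem theorem21 (S : Type) (add circ : S -> S -> S)
    (brace_S : dual_weak_brace add circ)
    (I : set S) (ideal_I : ideal add circ I) :
  exists congI : congruence add circ (ideal_rel add I),
    dual_weak_brace (quotient_add congI) (quotient_circ congI) /\
    idempotents_isomorphic (quotient_add congI) (quotient_circ congI)
      add circ.
Proof.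
have [braceS cliffC] := brace_S.
have cliffA := weak_brace_add_clifford braceS.
have [invA _ dist cV] := braceS.
have [normA _ normC] := ideal_I.
have relE := ideal_rel_add_circ brace_S ideal_I.
have congI : congruence add circ (ideal_rel add I).
  split; [exact: ideal_rel_equivalence|exact: ideal_rel_compatible|].
  by rewrite relE; exact: ideal_rel_compatible.
have squareA := ideal_rel_square (N := I) cliffA.
have squareC a : ideal_rel add I (circ a a) a ->
    ideal_rel add I a (pow0 circ a).
  by rewrite relE; exact: ideal_rel_square.
exists congI.
have qcliffA : clifford_semigroup (quotient_add congI).
  exact: quotient_clifford.
have qcliffC : clifford_semigroup (quotient_circ congI).
  exact: quotient_clifford.
have addE := quotient_op_class (cong_equiv congI) (cong_add congI).
have circE := quotient_op_class (cong_equiv congI) (cong_circ congI).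
have sginvA := sginv_class (cong_equiv congI) (cong_add congI) cliffA squareA.
have sginvC := sginv_class (cong_equiv congI) (cong_circ congI) cliffC squareC.
rewrite -/(quotient_add congI) in addE sginvA.
rewrite -/(quotient_circ congI) in circE sginvC.
split.
  split=> //; split; [by case: qcliffA|by case: qcliffC| |].
  - move=> X Y Z; have [a ->] := quotient_classP X.
    have [b ->] := quotient_classP Y; have [c ->] := quotient_classP Z.
    by rewrite sginvA !(circE, addE) dist.
  - move=> X; have [a ->] := quotient_classP X.
    by rewrite sginvA sginvC circE addE cV.
(* The degree of a chosen representative; the choice is harmless since related elements have equal
   degrees. *)
pose f (X : quotient (ideal_rel add I)) := pow0 add (sval (cid (svalP X))).
have fE a : f (class (ideal_rel add I) a) = pow0 add a.
  rewrite /f; case: cid => /= b ab.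
  by have [/(_ (eq_exist _ _ ab))[-> _] _] := class_eq (cong_equiv congI) a b.
exists f; split.
- split.
  + by move=> X _; exact: pow0_idempotent.
  (* Injectivity: an idempotent class is the class of the degree of any representative, so [f]
     determines it. *)
  + move=> X Y; rewrite !inE.
    have [a ->] := quotient_classP X; have [b ->] := quotient_classP Y.
    rewrite !fE => /(idempotent_class squareA) -> /(idempotent_class squareA) ->.
    by move=> ->.
  + move=> e ee; have ee0 := pow0_of_idempotent invA ee.
    exists (class (ideal_rel add I) e); last by rewrite fE.
    by rewrite /idempotents /= addE ee.
- move=> X Y _ _; have [a ->] := quotient_classP X.
  have [b ->] := quotient_classP Y.
  by rewrite addE !fE pow0M.
- move=> X Y _ _; have [a ->] := quotient_classP X.
  have [b ->] := quotient_classP Y.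
  by rewrite circE !fE (pow0_add_circ brace_S) pow0M.
Qed.
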